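(* The solution to the problem $\Sigma_{\tau,\tau'}$, when it exists, is unique. Likewise, the solution to the problem $\Sigma$, when it exists, is unique. (That is, each of the two problems has at most one solution.)
   Context: Fix constants $c,S>0$, reals $a_1<b_1$, $a_2<b_2$, put $\Omega=[a_1,b_1]\times[a_2,b_2]$, and let $0\le\tau<\tau'<\infty$. For a 4-tuple $N=(N_1,N_2,N_3,N_4)$ of real functions of $(t,x,y)$ put $Q(N)=2cS(N_2N_3-N_1N_4)$. The four-velocity planar Broadwell system is $$\partial_tN_1+c\,\partial_xN_1=Q(N),\quad \partial_tN_2+c\,\partial_yN_2=-Q(N),\quad \partial_tN_3-c\,\partial_yN_3=-Q(N),\quad \partial_tN_4-c\,\partial_xN_4=Q(N).$$ Problem $\Sigma_{\tau,\tau'}$: the system on $[\tau,\tau']\times\Omega$ with initial conditions $N_i(\tau,x,y)=N_i^\tau(x,y)$ for $(x,y)\in\Omega$, $i=1,\dots,4$, and boundary conditions, for $t\in[\tau,\tau']$, $x\in[a_1,b_1]$, $y\in[a_2,b_2]$: $N_1(t,a_1,y)=N_1^-(t,y)$, $N_2(t,x,a_2)=N_2^-(t,x)$, $N_3(t,x,b_2)=N_3^+(t,x)$, $N_4(t,b_1,y)=N_4^+(t,y)$. The data satisfy the compatibility conditions $N_1^\tau(a_1,y)=N_1^-(\tau,y)$, $N_2^\tau(x,a_2)=N_2^-(\tau,x)$, $N_3^\tau(x,b_2)=N_3^+(\tau,x)$, $N_4^\tau(b_1,y)=N_4^+(\tau,y)$. Problem $\Sigma$: the same with $\tau=0$ and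 the time interval $[\tau,\tau']$ replaced by $[0,+\infty)$ (initial data denoted $N_i^0$). All data are non-negative, continuous and bounded, with continuous and bounded first-order partial derivatives. A solution is a 4-tuple of real functions continuous on the whole (closed) domain, having continuous first-order partial derivatives in the interior of the domain except possibly on a finite number of planes, satisfying the system at interior points outside these planes, and satisfying the initial and boundary conditions. *)

(* Defs.v *)
From Stdlib Require Import Reals List.
From Coquelicot Require Import Coquelicot.
Open Scope R_scope.

Inductive vel : Set := V1 | V2 | V3 | V4.

Definition segment (a b : R) : R -> Prop := fun s => a <= s <= b.
Definition half_line (a : R) : R -> Prop := fun s => a <= s.

Definition interior {U : UniformSpace} (D : U -> Prop) : U -> Prop :=
  fun p => locally p D.

Definition bounded_on {U : Type} (D : U -> Prop) (f : U -> R) : Prop :=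
  exists M : R, forall p, D p -> Rabs (f p) <= M.

Definition prod_set (I J : R -> Prop) : R * R -> Prop :=
  fun p => I (fst p) /\ J (snd p).

(* Points are triples (t, x, y); [T] is the time interval. *)
Definition space_time (T : R -> Prop) (a1 b1 a2 b2 : R) : R * R * R -> Prop :=
  fun '(t, x, y) => T t /\ segment a1 b1 x /\ segment a2 b2 y.

(* Derivative relative to [I]: the usual one at interior points of an interval,
   the one-sided one at its end points. *)
Definition is_derive_within (I : R -> Prop) (f : R -> R) (x l : R) : Prop :=
  filterlim (fun z => (f z - f x) / (z - x)) (within I (locally' x)) (locally l).

Definition regular_datum (I J : R -> Prop) (f : R * R -> R) : Prop :=
  (forall p, prod_set I J p -> 0 <= f p) /\
  continuous_on (prod_set I J) f /\
  bounded_on (prod_set I J) f /\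
  exists f1 f2 : R * R -> R,
    (forall u v, I u -> J v ->
       is_derive_within I (fun s => f (s, v)) u (f1 (u, v)) /\
       is_derive_within J (fun s => f (u, s)) v (f2 (u, v))) /\
    continuous_on (prod_set I J) f1 /\ bounded_on (prod_set I J) f1 /\
    continuous_on (prod_set I J) f2 /\ bounded_on (prod_set I J) f2.

(* [Nb i] is the boundary datum of the i-th component: N_1^-(t,y), N_2^-(t,x),
   N_3^+(t,x), N_4^+(t,y). *)
Definition regular_data (a1 b1 a2 b2 : R) (T : R -> Prop)
    (N0 Nb : vel -> R * R -> R) : Prop :=
  (forall i, regular_datum (segment a1 b1) (segment a2 b2) (N0 i)) /\
  regular_datum T (segment a2 b2) (Nb V1) /\
  regular_datum T (segment a1 b1) (Nb V2) /\
  regular_datum T (segment a1 b1) (Nb V3) /\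
  regular_datum T (segment a2 b2) (Nb V4).

Definition compatible_data (a1 b1 a2 b2 tau : R)
    (N0 Nb : vel -> R * R -> R) : Prop :=
  (forall y, segment a2 b2 y -> N0 V1 (a1, y) = Nb V1 (tau, y)) /\
  (forall x, segment a1 b1 x -> N0 V2 (x, a2) = Nb V2 (tau, x)) /\
  (forall x, segment a1 b1 x -> N0 V3 (x, b2) = Nb V3 (tau, x)) /\
  (forall y, segment a2 b2 y -> N0 V4 (b1, y) = Nb V4 (tau, y)).

Definition admissible_data (a1 b1 a2 b2 : R) (T : R -> Prop) (tau : R)
    (N0 Nb : vel -> R * R -> R) : Prop :=
  regular_data a1 b1 a2 b2 T N0 Nb /\ compatible_data a1 b1 a2 b2 tau N0 Nb.

(* The plane alpha * t + beta * x + gamma * y = delta. *)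
Record plane : Set := Plane {
  alpha : R; beta : R; gamma : R; delta : R;
  plane_nondegenerate : alpha <> 0 \/ beta <> 0 \/ gamma <> 0
}.

Definition on_plane (P : plane) : R * R * R -> Prop :=
  fun '(t, x, y) => alpha P * t + beta P * x + gamma P * y = delta P.

Definition off_planes (Ps : list plane) : R * R * R -> Prop :=
  fun p => forall P, In P Ps -> ~ on_plane P p.

Definition d_t (f : R * R * R -> R) : R * R * R -> R :=
  fun '(t, x, y) => Derive (fun s => f (s, x, y)) t.
Definition d_x (f : R * R * R -> R) : R * R * R -> R :=
  fun '(t, x, y) => Derive (fun s => f (t, s, y)) x.
Definition d_y (f : R * R * R -> R) : R * R * R -> R :=
  fun '(t, x, y) => Derive (fun s => f (t, x, s)) y.

(* Used only for open [U]. *)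
Definition C1_on (U : R * R * R -> Prop) (f : R * R * R -> R) : Prop :=
  (forall t x y, U (t, x, y) ->
     ex_derive (fun s => f (s, x, y)) t /\
     ex_derive (fun s => f (t, s, y)) x /\
     ex_derive (fun s => f (t, x, s)) y) /\
  continuous_on U (d_t f) /\ continuous_on U (d_x f) /\ continuous_on U (d_y f).

Definition Q (c S : R) (N : vel -> R * R * R -> R) (p : R * R * R) : R :=
  2 * c * S * (N V2 p * N V3 p - N V1 p * N V4 p).

Definition broadwell_at (c S : R) (N : vel -> R * R * R -> R)
    (p : R * R * R) : Prop :=
  d_t (N V1) p + c * d_x (N V1) p = Q c S N p /\
  d_t (N V2) p + c * d_y (N V2) p = - Q c S N p /\
  d_t (N V3) p - c * d_y (N V3) p = - Q c S N p /\
  d_t (N V4) p - c * d_x (N V4) p = Q c S N p.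

Definition initial_conditions (a1 b1 a2 b2 tau : R) (N0 : vel -> R * R -> R)
    (N : vel -> R * R * R -> R) : Prop :=
  forall i x y, segment a1 b1 x -> segment a2 b2 y ->
    N i (tau, x, y) = N0 i (x, y).

Definition boundary_conditions (a1 b1 a2 b2 : R) (T : R -> Prop)
    (Nb : vel -> R * R -> R) (N : vel -> R * R * R -> R) : Prop :=
  forall t x y, T t -> segment a1 b1 x -> segment a2 b2 y ->
    N V1 (t, a1, y) = Nb V1 (t, y) /\
    N V2 (t, x, a2) = Nb V2 (t, x) /\
    N V3 (t, x, b2) = Nb V3 (t, x) /\
    N V4 (t, b1, y) = Nb V4 (t, y).

Definition is_solution (c S a1 b1 a2 b2 : R) (T : R -> Prop) (tau : R)
    (N0 Nb : vel -> R * R -> R) (N : vel -> R * R * R -> R) : Prop :=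
  (forall i, continuous_on (space_time T a1 b1 a2 b2) (N i)) /\
  (exists Ps : list plane,
     let U := fun p => interior (space_time T a1 b1 a2 b2) p /\ off_planes Ps p in
     (forall i, C1_on U (N i)) /\ (forall p, U p -> broadwell_at c S N p)) /\
  initial_conditions a1 b1 a2 b2 tau N0 N /\
  boundary_conditions a1 b1 a2 b2 T Nb N.

Definition Sigma_fin_data (a1 b1 a2 b2 tau tau' : R)
    (N0 Nb : vel -> R * R -> R) : Prop :=
  admissible_data a1 b1 a2 b2 (segment tau tau') tau N0 Nb.

Definition Sigma_fin_solution (c S a1 b1 a2 b2 tau tau' : R)
    (N0 Nb : vel -> R * R -> R) (N : vel -> R * R * R -> R) : Prop :=
  is_solution c S a1 b1 a2 b2 (segment tau tau') tau N0 Nb N.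

Definition Sigma_data (a1 b1 a2 b2 : R) (N0 Nb : vel -> R * R -> R) : Prop :=
  admissible_data a1 b1 a2 b2 (half_line 0) 0 N0 Nb.

Definition Sigma_solution (c S a1 b1 a2 b2 : R)
    (N0 Nb : vel -> R * R -> R) (N : vel -> R * R * R -> R) : Prop :=
  is_solution c S a1 b1 a2 b2 (half_line 0) 0 N0 Nb N.

(* Main.v *)
Require Import Defs.
From Stdlib Require Import Reals Lra List Classical ClassicalEpsilon.
From Coquelicot Require Import Coquelicot.
Open Scope R_scope.

(** Two solutions with the same data agree because their difference obeys a
    Gronwall estimate along characteristics.

    Each component [N i] is transported with a constant velocity, so the system
    says that along a characteristic its derivative is plus or minus [Q].  A
    point of the open box, followed backwards along the i-th characteristic,
    stays in the open box until it meets either the initial slice or exactly the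
    face on which the i-th component is prescribed ([characteristic_entry]); at
    that entry point the two solutions coincide.  On a compact time interval
    both are bounded by some A ([bounded_on_box]), hence [Q] is Lipschitz there
    ([Q_lipschitz]).  If all four differences are at most B exp(lam t) with
    lam = 16cSA, each of them changes along its characteristic at a rate of at
    most 8cSA B exp(lam s) = (lam / 2) B exp(lam s); integrating from the entry
    time up to t gives the former bound with B halved ([difference_halves]).  Iterating, the differences vanish.

    Because of the exceptional planes, the estimate along a characteristic is
    first made for end points lying off the planes.  Such a characteristic lies
    in none of them, hence meets them in finitely many points
    ([line_off_planes]), and the mean value inequality for continuous functions
    tolerates finitely many points where nothing is known about the derivative
    ([mean_value_off_finite]).  The end points off the planes are dense, and
    both sides of the estimate are continuous on the closed box, so it extends
    to all of it ([le_by_density]).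

    For the unbounded time interval, a solution restricts to a solution on every
    [[0, t + 1]], and the closed box over that interval contains all points at
    time t. *)

(** * Continuity relative to a set *)

Lemma continuous_on_minus {T : UniformSpace} (D : T -> Prop) (f g : T -> R) :
  continuous_on D f -> continuous_on D g ->
  continuous_on D (fun p => f p - g p).
Proof.
  intros hf hg p hp.
  apply (filterlim_comp_2 _ _ Rminus (hf p hp) (hg p hp)).
  exact (filterlim_comp_2 _ _ Rplus filterlim_fst
    (filterlim_comp _ _ _ _ _ _ _ _ filterlim_snd (filterlim_opp (g p)))
    (filterlim_plus (f p) (- g p))).
Qed.

Lemma continuous_on_comp {T U V : UniformSpace} (D : T -> Prop) (E : U -> Prop)
    (g : T -> U) (f : U -> V) :
  (forall p, D p -> E (g p)) ->
  continuous_on D g -> continuous_on E f ->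
  continuous_on D (fun p => f (g p)).
Proof.
  intros hDE hg hf p hp P hP.
  pose proof (hg p hp _ (hf (g p) (hDE p hp) P hP)) as H.
  unfold filtermap, within in *.
  revert H; apply filter_imp; intros q hq hqD; auto.
Qed.

Lemma continuous_pair {T U V : UniformSpace} (f : T -> U) (g : T -> V) (s : T) :
  continuous f s -> continuous g s -> continuous (fun r => (f r, g r)) s.
Proof.
  intros hf hg; apply filterlim_locally; intros eps.
  exact (filter_and _ _ (proj1 (filterlim_locally _ _) hf eps)
    (proj1 (filterlim_locally _ _) hg eps)).
Qed.

(** A finite subcover argument: the compactness theorem for boxes takes a radius
    function, which is chosen so that [f] varies by less than 1 on each ball. *)
Lemma bounded_on_box (f : R * R * R -> R) (t0 t1 a1 b1 a2 b2 : R) :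
  continuous_on (space_time (segment t0 t1) a1 b1 a2 b2) f ->
  bounded_on (space_time (segment t0 t1) a1 b1 a2 b2) f.
Proof.
  intros hf; set (D := space_time (segment t0 t1) a1 b1 a2 b2) in *.
  set (pt := fun q : Compactness.Tn 3 R =>
               let '(t, (x, (y, _))) := q in (t, x, y)).
  assert (hloc : forall q, exists d : posreal, D (pt q) ->
            forall p, ball (pt q) d p -> D p -> Rabs (f p - f (pt q)) < 1).
  { intros q; destruct (classic (D (pt q))) as [hq|hq].
    - destruct (proj1 (filterlim_locally f (f (pt q))) (hf _ hq)
                  (mkposreal 1 Rlt_0_1)) as [d hd].
      exists d; intros _ p hp hDp; exact (hd p hp hDp).
    - exists (mkposreal 1 Rlt_0_1); intros; contradiction. }
  set (delta := fun q => proj1_sig (constructive_indefinite_description _ (hloc q))).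
  assert (hdelta : forall q p, D (pt q) -> ball (pt q) (delta q) p -> D p ->
            Rabs (f p - f (pt q)) < 1).
  { intros q p hq hp hDp; unfold delta in hp.
    destruct constructive_indefinite_description as [d hd]; simpl in hp; auto. }
  destruct (NNPP _ (compactness_list 3 (t0, (a1, (a2, tt))) (t1, (b1, (b2, tt)))
                      delta)) as [l hl].
  assert (hmax : exists M, forall q, In q l -> Rabs (f (pt q)) <= M).
  { clear hl; induction l as [|q l [M hM]].
    - exists 0; intros _ [].
    - exists (Rmax (Rabs (f (pt q))) M); intros r [<-|hr].
      + apply Rmax_l.
      + apply Rle_trans with M; [auto | apply Rmax_r]. }
  destruct hmax as [M hM].
  exists (M + 1); intros [[t x] y] hp.
  destruct (hl (t, (x, (y, tt)))) as [[t' [x' [y' []]]] [hin [hb hc]]].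
  { destruct hp as [ht [hx hy]]; repeat split; apply ht || apply hx || apply hy. }
  specialize (hM _ hin).
  assert (hq : D (t', x', y')).
  { destruct hb as [ht [hx [hy _]]]; repeat split; apply ht || apply hx || apply hy. }
  assert (H : Rabs (f (t, x, y) - f (t', x', y')) < 1).
  { apply (hdelta (t', (x', (y', tt)))); auto.
    destruct hc as [ht [hx [hy _]]]; repeat split; assumption. }
  change (pt (t', (x', (y', tt)))) with (t', x', y') in hM.
  replace (f (t, x, y)) with
    (f (t', x', y') + (f (t, x, y) - f (t', x', y'))) by ring.
  eapply Rle_trans; [apply Rabs_triang | lra].
Qed.

(** * Mean value inequalities with exceptional points *)

(** Composing with the projection onto a segment turns continuity relative to
    the segment into continuity on the line, as the mean value theorem wants. *)
Definition clamp (a b s : R) : R := Rmax a (Rmin b s).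

Lemma clamp_id (a b s : R) : a <= s <= b -> clamp a b s = s.
Proof. intros; unfold clamp, Rmax, Rmin; repeat destruct Rle_dec; lra. Qed.

Lemma clamp_segment (a b s : R) : a <= b -> a <= clamp a b s <= b.
Proof. intros; unfold clamp, Rmax, Rmin; repeat destruct Rle_dec; lra. Qed.

Lemma continuous_clamp (a b s : R) : continuous (clamp a b) s.
Proof.
  apply filterlim_locally; intros eps; exists eps; intros z hz.
  apply Rle_lt_trans with (2 := hz).
  change (Rabs (clamp a b z - clamp a b s) <= Rabs (z - s)).
  unfold clamp, Rmax, Rmin; repeat destruct Rle_dec; unfold Rabs;
    repeat destruct Rcase_abs; lra.
Qed.

(** Splitting the segment at an exceptional point removes it from the list of
    interior ones, so the mean value theorem applies on each final piece. *)
Lemma nondecreasing_off_finite (l : list R) (H : R -> R) (a b : R) :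
  a <= b -> continuous_on (segment a b) H ->
  (forall s, a < s < b -> ~ In s l -> exists d, is_derive H s d /\ 0 <= d) ->
  H a <= H b.
Proof.
  revert a b; induction l as [|r l IH]; intros a b hab hc hd.
  - destruct hab as [hab|<-]; [|lra].
    set (G := fun s => H (clamp a b s)).
    (* The intermediate point may be an end point, where [H] need not have a
       derivative; truncating at 0 makes the sign known there too. *)
    destruct (MVT_gen G a b (fun s => Rmax 0 (Derive H s))) as [z [_ hz]].
    + rewrite Rmin_left, Rmax_right by lra; intros s hs.
      destruct (hd s hs (fun h => h)) as [d [hd1 hd2]].
      rewrite (is_derive_unique _ _ _ hd1), Rmax_right by lra.
      apply is_derive_ext_loc with (2 := hd1).
      assert (he : 0 < Rmin (s - a) (b - s)) by (apply Rmin_glb_lt; lra).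
      exists (mkposreal _ he); intros z hz; unfold G; rewrite clamp_id; auto.
      apply Rabs_def2 in hz; simpl in hz.
      pose proof (Rmin_l (s - a) (b - s)); pose proof (Rmin_r (s - a) (b - s)).
      unfold minus, plus, opp in hz; simpl in hz; lra.
    + intros s _; apply continuity_pt_filterlim.
      assert (hG : continuous_on (fun _ => True) G).
      { apply continuous_on_comp with (E := segment a b) (g := clamp a b); auto.
        - intros; apply clamp_segment; lra.
        - apply continuous_on_forall; intros; apply continuous_clamp. }
      apply (continuous_continuous_on _ G s) in hG; auto.
      now apply filter_forall.
    + unfold G in hz; rewrite !clamp_id in hz by lra.
      pose proof (Rmax_l 0 (Derive H z)).
      assert (0 <= Rmax 0 (Derive H z) * (b - a)) by (apply Rmult_le_pos; lra).
      lra.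
  - assert (hsub : forall u v, a <= u -> v <= b -> u <= v ->
              (forall s, u < s < v -> s <> r) -> H u <= H v).
    { intros u v hu hv huv hr; apply IH; auto.
      - apply continuous_on_subset with (2 := hc); unfold segment; intros; lra.
      - intros s hs hin; apply hd; [lra|]; intros [<-|h]; [|auto].
        now apply (hr r). }
    destruct (Rlt_dec a r) as [h1|h1]; [destruct (Rlt_dec r b) as [h2|h2]|].
    + apply Rle_trans with (H r); apply hsub; lra || (intros; lra).
    + apply hsub; lra || (intros; lra).
    + apply hsub; lra || (intros; lra).
Qed.

(** Both [g - F] and [g + F] are nondecreasing. *)
Lemma mean_value_off_finite (l : list R) (F g dg : R -> R) (a b : R) :
  a <= b -> continuous_on (segment a b) F ->
  (forall s, is_derive g s (dg s)) ->
  (forall s, a < s < b -> ~ In s l ->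
     exists d, is_derive F s d /\ Rabs d <= dg s) ->
  Rabs (F b - F a) <= g b - g a.
Proof.
  intros hab hF hg hd.
  assert (hgc : continuous_on (segment a b) g).
  { apply continuous_on_forall; intros s _.
    apply (ex_derive_continuous g s); exists (dg s); auto. }
  assert (h1 : g a - F a <= g b - F b).
  { apply (nondecreasing_off_finite l (fun s => g s - F s)); auto.
    - now apply continuous_on_minus.
    - intros s hs hl; destruct (hd s hs hl) as [d [hd1 hd2]].
      exists (dg s - d); split.
      + apply (is_derive_minus g F); auto.
      + apply Rabs_le_between in hd2; lra. }
  assert (h2 : g a - (0 - F a) <= g b - (0 - F b)).
  { apply (nondecreasing_off_finite l (fun s => g s - (0 - F s))); auto.
    - apply continuous_on_minus; auto; apply continuous_on_minus; auto.
      apply continuous_on_forall; intros; apply continuous_const.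
    - intros s hs hl; destruct (hd s hs hl) as [d [hd1 hd2]].
      exists (dg s - (0 - d)); split.
      + apply (is_derive_minus g (fun s => 0 - F s)); auto.
        apply (is_derive_minus (fun _ => 0) F); auto.
        apply (is_derive_const 0 s).
      + apply Rabs_le_between in hd2; lra. }
  apply Rabs_le_between; lra.
Qed.

Lemma increment_approx (g : R -> R) (l e u h : R) :
  (forall z, Rabs (z - u) <= Rabs h ->
     ex_derive g z /\ Rabs (Derive g z - l) <= e) ->
  Rabs (g (u + h) - g u - l * h) <= e * Rabs h.
Proof.
  intros H.
  assert (hin : forall z, Rmin u (u + h) <= z <= Rmax u (u + h) ->
            Rabs (z - u) <= Rabs h).
  { intros z; unfold Rmin, Rmax; repeat destruct Rle_dec; unfold Rabs;
      repeat destruct Rcase_abs; lra. }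
  destruct (MVT_gen g u (u + h) (Derive g)) as [z [hz heq]].
  - intros z hz; apply Derive_correct, H, hin; lra.
  - intros z hz; apply continuity_pt_filterlim.
    apply (ex_derive_continuous g z), H, hin, hz.
  - rewrite heq.
    replace (Derive g z * (u + h - u) - l * h) with ((Derive g z - l) * h) by ring.
    rewrite Rabs_mult; apply Rmult_le_compat_r; [apply Rabs_pos|].
    apply H, hin, hz.
Qed.

(** * Differentiation along characteristics *)

(** The line with velocity (u, v), parametrised by time; (x0, y0) is its
    position at time 0. *)
Definition line (u v x0 y0 s : R) : R * R * R := (s, x0 + u * s, y0 + v * s).

(** The chain rule in three variables, with continuous partial derivatives: the
    increment along the line is the sum of three increments parallel to the axes,
    each controlled by [increment_approx]. *)
Lemma is_derive_along_line (U : R * R * R -> Prop) (f : R * R * R -> R)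
    (u v x0 y0 s : R) :
  C1_on U f -> locally (line u v x0 y0 s) U ->
  is_derive (fun r => f (line u v x0 y0 r)) s
    (d_t f (line u v x0 y0 s) + u * d_x f (line u v x0 y0 s)
       + v * d_y f (line u v x0 y0 s)).
Proof.
  intros [hex [ht [hx hy]]] hU; set (p := line u v x0 y0 s) in *.
  assert (hUp : U p) by now apply locally_singleton.
  apply is_derive_Reals; intros eps heps.
  set (k := 1 + Rabs u + Rabs v).
  pose proof (Rabs_pos u); pose proof (Rabs_pos v).
  assert (hk : 0 < k) by (unfold k; lra).
  assert (he : 0 < eps / (2 * k)) by (apply Rdiv_lt_0_compat; lra).
  set (e := mkposreal _ he).
  (* These three hold relative to U, which is a neighbourhood of p. *)
  pose proof (proj1 (filterlim_locally _ _) (ht p hUp) e) as ht'.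
  pose proof (proj1 (filterlim_locally _ _) (hx p hUp) e) as hx'.
  pose proof (proj1 (filterlim_locally _ _) (hy p hUp) e) as hy'.
  destruct (filter_and _ _ hU (filter_and _ _ ht' (filter_and _ _ hx' hy')))
    as [d hd]; clear ht' hx' hy'.
  assert (hnear : forall t x y, Rabs (t - s) < d -> Rabs (x - (x0 + u * s)) < d ->
    Rabs (y - (y0 + v * s)) < d -> U (t, x, y) /\
    Rabs (d_t f (t, x, y) - d_t f p) <= e /\
    Rabs (d_x f (t, x, y) - d_x f p) <= e /\
    Rabs (d_y f (t, x, y) - d_y f p) <= e).
  { intros t x y k1 k2 k3.
    destruct (hd (t, x, y) (conj (conj k1 k2) k3)) as [hq hq'].
    destruct (hq' hq) as [q1 [q2 q3]].
    exact (conj hq (conj (Rlt_le _ _ q1) (conj (Rlt_le _ _ q2) (Rlt_le _ _ q3)))). }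
  assert (hdk : 0 < d / k) by (apply Rdiv_lt_0_compat; [apply d|lra]).
  exists (mkposreal _ hdk); intros h hh0 hh; simpl in hh.
  assert (hhk : Rabs h * k < d).
  { apply Rmult_lt_compat_r with (r := k) in hh; auto.
    replace (d / k * k) with (pos d) in hh by (field; lra); exact hh. }
  pose proof (Rabs_pos h) as hpos.
  assert (hb1 : Rabs h < d).
  { apply Rle_lt_trans with (2 := hhk); unfold k.
    rewrite <- (Rmult_1_r (Rabs h)) at 1; apply Rmult_le_compat_l; lra. }
  assert (hb2 : Rabs (u * h) < d).
  { apply Rle_lt_trans with (2 := hhk); unfold k; rewrite Rabs_mult, Rmult_comm.
    apply Rmult_le_compat_l; lra. }
  assert (hb3 : Rabs (v * h) < d).
  { apply Rle_lt_trans with (2 := hhk); unfold k; rewrite Rabs_mult, Rmult_comm.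
    apply Rmult_le_compat_l; lra. }
  assert (hz : forall z, Rabs (z - z) < d).
  { intros z; rewrite Rminus_eq_0, Rabs_R0; apply d. }
  assert (hadd : forall z w, Rabs w < d -> Rabs (z + w - z) < d).
  { intros z w hw; replace (z + w - z) with w by ring; exact hw. }
  set (x1 := x0 + u * s) in *; set (y1 := y0 + v * s) in *.
  pose proof (increment_approx (fun t => f (t, x1 + u * h, y1 + v * h))
                (d_t f p) e s h) as it.
  pose proof (increment_approx (fun x => f (s, x, y1 + v * h))
                (d_x f p) e x1 (u * h)) as ix.
  pose proof (increment_approx (fun y => f (s, x1, y)) (d_y f p) e y1 (v * h)) as iy.
  cbv beta in it, ix, iy.
  assert (jt : Rabs (f (s + h, x1 + u * h, y1 + v * h) -
                f (s, x1 + u * h, y1 + v * h) - d_t f p * h) <= e * Rabs h).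
  { apply it; intros z hzz.
    destruct (hnear z (x1 + u * h) (y1 + v * h)) as [q [q1 _]]; auto; [lra|].
    split; [apply (hex _ _ _ q) | exact q1]. }
  assert (jx : Rabs (f (s, x1 + u * h, y1 + v * h) -
                f (s, x1, y1 + v * h) - d_x f p * (u * h)) <= e * Rabs (u * h)).
  { apply ix; intros z hzz.
    destruct (hnear s z (y1 + v * h)) as [q [_ [q1 _]]]; auto; [lra|].
    split; [apply (hex _ _ _ q) | exact q1]. }
  assert (jy : Rabs (f (s, x1, y1 + v * h) - f (s, x1, y1) - d_y f p * (v * h))
                <= e * Rabs (v * h)).
  { apply iy; intros z hzz.
    destruct (hnear s x1 z) as [q [_ [_ q1]]]; auto; [lra|].
    split; [apply (hex _ _ _ q) | exact q1]. }
  clear it ix iy.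
  unfold line.
  replace (x0 + u * (s + h)) with (x1 + u * h) by (unfold x1; ring).
  replace (y0 + v * (s + h)) with (y1 + v * h) by (unfold y1; ring).
  fold x1 y1.
  set (A := f (s + h, x1 + u * h, y1 + v * h)) in *.
  set (B := f (s, x1 + u * h, y1 + v * h)) in *.
  set (C := f (s, x1, y1 + v * h)) in *.
  set (E := f (s, x1, y1)) in *.
  replace ((A - E) / h - (d_t f p + u * d_x f p + v * d_y f p)) with
    (((A - B - d_t f p * h) + (B - C - d_x f p * (u * h)) +
      (C - E - d_y f p * (v * h))) / h) by (field; exact hh0).
  assert (hh1 : 0 < Rabs h) by now apply Rabs_pos_lt.
  unfold Rdiv; rewrite Rabs_mult, Rabs_inv.
  apply Rmult_lt_reg_r with (Rabs h); auto.
  rewrite Rmult_assoc, Rinv_l, Rmult_1_r by lra.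
  rewrite Rabs_mult in jx, jy.
  apply Rle_lt_trans with (e * k * Rabs h).
  - eapply Rle_trans; [apply Rabs_triang|].
    eapply Rle_trans; [apply Rplus_le_compat_r, Rabs_triang|].
    unfold k; lra.
  - apply Rmult_lt_compat_r; auto.
    simpl; replace (eps / (2 * k) * k) with (eps / 2) by (field; lra); lra.
Qed.

(** * Exceptional planes and density *)

Lemma off_planes_app (Ps Ps' : list plane) (p : R * R * R) :
  off_planes (Ps ++ Ps') p -> off_planes Ps p /\ off_planes Ps' p.
Proof. intros h; split; intros P hP; apply h, in_or_app; auto. Qed.

Lemma off_plane_open (P : plane) (p : R * R * R) :
  ~ on_plane P p -> locally p (fun q => ~ on_plane P q).
Proof.
  destruct p as [[t x] y]; simpl; intros hp.
  set (h := fun q : R * R * R =>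
              alpha P * fst (fst q) + beta P * snd (fst q) + gamma P * snd q).
  assert (hc : continuous h (t, x, y)).
  { assert (h1 : continuous (fun q : R * R * R => fst (fst q)) (t, x, y)).
    { apply continuous_comp; [apply continuous_fst|apply continuous_fst]. }
    assert (h2 : continuous (fun q : R * R * R => snd (fst q)) (t, x, y)).
    { apply continuous_comp; [apply continuous_fst|apply continuous_snd]. }
    assert (h3 : continuous (fun q : R * R * R => snd q) (t, x, y))
      by apply continuous_snd.
    assert (hscal : forall (a : R) (g : R * R * R -> R),
              continuous g (t, x, y) -> continuous (fun q => a * g q) (t, x, y)).
    { intros a g; exact (continuous_scal_r (V := R_NormedModule) a g (t, x, y)). }
    exact (continuous_plus (V := R_NormedModule) _ _ _
      (continuous_plus (V := R_NormedModule) _ _ _ (hscal _ _ h1) (hscal _ _ h2))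
      (hscal _ _ h3)). }
  assert (hne : locally (h (t, x, y)) (fun z => z <> delta P)).
  { apply (open_neq (delta P)); exact hp. }
  generalize (hc _ hne); unfold filtermap.
  apply filter_imp; intros [[t' x'] y'] hq; exact hq.
Qed.

Lemma off_planes_open (Ps : list plane) (p : R * R * R) :
  off_planes Ps p -> locally p (off_planes Ps).
Proof.
  induction Ps as [|P Ps IH]; intros hp.
  - apply filter_forall; intros q P [].
  - generalize (filter_and _ _ (off_plane_open P p (hp P (or_introl eq_refl)))
      (IH (fun P' h => hp P' (or_intror h)))).
    apply filter_imp; intros q [h1 h2] P' [<-|h]; auto.
Qed.

(** One plane at a time: being off the planes treated so far is an open
    condition, so it survives a small move off the next one. *)
Lemma off_planes_dense (Ps : list plane) (p : R * R * R) (eps : posreal) :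
  exists q, ball p eps q /\ off_planes Ps q.
Proof.
  revert eps; induction Ps as [|P Ps IH]; intros eps.
  - exists p; split; [apply ball_center | intros P []].
  - destruct (IH (pos_div_2 eps)) as [q [hq hoff]].
    destruct (classic (on_plane P q)) as [hP|hP].
    2: { exists q; split.
         - apply ball_le with (2 := hq); simpl; pose proof (cond_pos eps); lra.
         - intros P' [<-|h]; auto. }
    destruct (off_planes_open Ps q hoff) as [d hd].
    set (m := Rmin d (pos_div_2 eps)).
    assert (hm : 0 < m) by (apply Rmin_glb_lt; [apply d | apply pos_div_2]).
    destruct q as [[t x] y].
    set (n2 := alpha P * alpha P + beta P * beta P + gamma P * gamma P).
    set (n1 := 1 + Rabs (alpha P) + Rabs (beta P) + Rabs (gamma P)).
    assert (hn2 : 0 < n2).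
    { unfold n2; pose proof (Rle_0_sqr (alpha P)); pose proof (Rle_0_sqr (beta P));
        pose proof (Rle_0_sqr (gamma P)); unfold Rsqr in *.
      destruct (plane_nondegenerate P) as [h|[h|h]];
        apply Rsqr_pos_lt in h; unfold Rsqr in h; lra. }
    pose proof (Rabs_pos (alpha P)); pose proof (Rabs_pos (beta P));
      pose proof (Rabs_pos (gamma P)).
    assert (hn1 : 0 < n1) by (unfold n1; lra).
    assert (hs : 0 < m / n1) by (apply Rdiv_lt_0_compat; lra).
    (* Moving along the normal leaves the plane at once. *)
    set (q' := (t + m / n1 * alpha P, x + m / n1 * beta P, y + m / n1 * gamma P)).
    assert (hball : ball (t, x, y) m q').
    { assert (hc : forall z w, Rabs w < n1 -> Rabs (z + m / n1 * w - z) < m).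
      { intros z w hw; replace (z + m / n1 * w - z) with (m / n1 * w) by ring.
        rewrite Rabs_mult, (Rabs_pos_eq (m / n1)) by lra.
        replace m with (m / n1 * n1) at 2 by (field; lra).
        apply Rmult_lt_compat_l; lra. }
      unfold n1 in hc; repeat split; apply hc; lra. }
    exists q'; split.
    + replace (pos eps) with (eps / 2 + eps / 2) by field.
      apply ball_triangle with (1 := hq).
      apply ball_le with (2 := hball); apply Rmin_r.
    + intros P' [<-|h].
      * simpl in hP |- *; intros hP'.
        assert (m / n1 * n2 = 0) by (unfold n2; lra).
        assert (0 < m / n1 * n2) by now apply Rmult_lt_0_compat.
        lra.
      * apply hd; auto; apply ball_le with (2 := hball); apply Rmin_l.
Qed.

(** A line not contained in a plane meets it at most once; here no plane contains
    the line because the point at time [t] is off all of them. *)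
Lemma line_off_planes (Ps : list plane) (u v x0 y0 t : R) :
  off_planes Ps (line u v x0 y0 t) ->
  exists l, forall s, ~ In s l -> off_planes Ps (line u v x0 y0 s).
Proof.
  intros hp; induction Ps as [|P Ps IH].
  - exists nil; intros s _ P [].
  - destruct IH as [l hl]; [intros P' h; apply hp; now right|].
    (* Along the line the equation of the plane is k * (s - t) + r = 0. *)
    set (k := alpha P + beta P * u + gamma P * v).
    set (r := alpha P * t + beta P * (x0 + u * t) + gamma P * (y0 + v * t) - delta P).
    assert (hr : r <> 0).
    { intros hr; apply (hp P (or_introl eq_refl)); unfold r in hr; simpl; lra. }
    exists (t - r / k :: l); intros s hs P' [<-|h].
    2: { apply hl; auto; intros hin; apply hs; now right. }
    simpl; intros hon.
    assert (hk : k * (s - t) + r = 0) by (unfold k, r; lra).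
    destruct (Req_dec k 0) as [hk0|hk0].
    + rewrite hk0 in hk; lra.
    + apply hs; left.
      replace r with (k * (t - s)) by lra; field; exact hk0.
Qed.

Definition open_box (t0 t1 a1 b1 a2 b2 : R) : R * R * R -> Prop :=
  fun '(t, x, y) => t0 < t < t1 /\ a1 < x < b1 /\ a2 < y < b2.

Lemma locally_open_interval (a b x : R) :
  a < x < b -> locally x (fun z => a < z < b).
Proof. intros h; apply (open_and _ _ (open_gt a) (open_lt b)); exact h. Qed.

Lemma open_box_open (t0 t1 a1 b1 a2 b2 : R) (p : R * R * R) :
  open_box t0 t1 a1 b1 a2 b2 p -> locally p (open_box t0 t1 a1 b1 a2 b2).
Proof.
  destruct p as [[t x] y]; intros [ht [hx hy]].
  destruct (locally_open_interval _ _ _ ht) as [d1 h1].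
  destruct (locally_open_interval _ _ _ hx) as [d2 h2].
  destruct (locally_open_interval _ _ _ hy) as [d3 h3].
  assert (hd : 0 < Rmin d1 (Rmin d2 d3)).
  { repeat apply Rmin_glb_lt; apply cond_pos. }
  exists (mkposreal _ hd); intros [[t' x'] y'] [[b1' b2'] b3']; simpl in *.
  pose proof (Rmin_r d1 (Rmin d2 d3)) as hr.
  specialize (h1 t' (Rlt_le_trans _ _ _ b1' (Rmin_l _ _))).
  specialize (h2 x' (Rlt_le_trans _ _ _ b2' (Rle_trans _ _ _ hr (Rmin_l _ _)))).
  specialize (h3 y' (Rlt_le_trans _ _ _ b3' (Rle_trans _ _ _ hr (Rmin_r _ _)))).
  auto.
Qed.

Lemma open_box_interior (t0 t1 a1 b1 a2 b2 : R) (p : R * R * R) :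
  open_box t0 t1 a1 b1 a2 b2 p ->
  Defs.interior (space_time (segment t0 t1) a1 b1 a2 b2) p.
Proof.
  intros hp; apply open_box_open in hp; unfold Defs.interior; revert hp.
  apply filter_imp.
  intros [[t x] y] [ht [hx hy]]; unfold space_time, segment; lra.
Qed.

Lemma le_by_density (t0 t1 a1 b1 a2 b2 : R) (Ps : list plane)
    (f g : R * R * R -> R) :
  t0 < t1 -> a1 < b1 -> a2 < b2 ->
  continuous_on (space_time (segment t0 t1) a1 b1 a2 b2) f ->
  continuous_on (space_time (segment t0 t1) a1 b1 a2 b2) g ->
  (forall p, open_box t0 t1 a1 b1 a2 b2 p -> off_planes Ps p -> f p <= g p) ->
  forall p, space_time (segment t0 t1) a1 b1 a2 b2 p -> f p <= g p.
Proof.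
  intros ht hx hy hf hg hfg p hp; apply Rnot_lt_le; intros hlt.
  pose proof (continuous_on_minus _ _ _ hf hg p hp) as hc.
  destruct (hc (fun z => 0 < z)) as [d hd]; [apply open_gt; lra|].
  cbv beta in hd.
  destruct p as [[t x] y]; destruct hp as [hpt [hpx hpy]]; unfold segment in *.
  (* Pull p slightly towards the centre, by a fraction r of the way. *)
  set (w := 1 + (t1 - t0) + (b1 - a1) + (b2 - a2)).
  assert (hw : 0 < w) by (unfold w; lra).
  set (r := Rmin 1 (d / (2 * w))).
  assert (hr : 0 < r).
  { apply Rmin_glb_lt; [lra|]; apply Rdiv_lt_0_compat; [apply d|lra]. }
  assert (hr1 : r <= 1) by apply Rmin_l.
  assert (hrw : r * w <= d / 2).
  { apply Rle_trans with (d / (2 * w) * w); [|right; field; lra].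
    apply Rmult_le_compat_r; [lra|apply Rmin_r]. }
  assert (hpull : forall a b z, a < b -> b - a < w -> a <= z <= b ->
            a < z + r * ((a + b) / 2 - z) < b /\
            Rabs (z + r * ((a + b) / 2 - z) - z) < d / 2).
  { intros a b z hab hbw hz; split.
    - assert (0 <= (1 - r) * (z - a)) by (apply Rmult_le_pos; lra).
      assert (0 <= (1 - r) * (b - z)) by (apply Rmult_le_pos; lra).
      assert (0 < r * (b - a)) by (apply Rmult_lt_0_compat; lra).
      lra.
    - apply Rlt_le_trans with (2 := hrw).
      replace (z + r * ((a + b) / 2 - z) - z) with (r * ((a + b) / 2 - z)) by ring.
      rewrite Rabs_mult, (Rabs_pos_eq r) by lra.
      apply Rmult_lt_compat_l; auto; apply Rabs_def1; lra. }
  destruct (hpull t0 t1 t ht ltac:(unfold w; lra) hpt) as [it bt].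
  destruct (hpull a1 b1 x hx ltac:(unfold w; lra) hpx) as [ix bx].
  destruct (hpull a2 b2 y hy ltac:(unfold w; lra) hpy) as [iy by'].
  set (c := (t + r * ((t0 + t1) / 2 - t), x + r * ((a1 + b1) / 2 - x),
             y + r * ((a2 + b2) / 2 - y))).
  assert (hbox : locally c (open_box t0 t1 a1 b1 a2 b2)).
  { apply open_box_open; repeat split; apply it || apply ix || apply iy. }
  destruct hbox as [d' hd'].
  assert (hm : 0 < Rmin d' (d / 2)).
  { apply Rmin_glb_lt; [apply d'|]; pose proof (cond_pos d); lra. }
  destruct (off_planes_dense Ps c (mkposreal _ hm)) as [q [hq hoff]].
  assert (hqbox : open_box t0 t1 a1 b1 a2 b2 q).
  { apply hd'; apply ball_le with (2 := hq); apply Rmin_l. }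
  specialize (hfg q hqbox hoff).
  assert (0 < f q - g q); [|lra].
  apply hd.
  - replace (pos d) with (d / 2 + d / 2) by field.
    apply ball_triangle with c; [now repeat split|].
    apply ball_le with (2 := hq); apply Rmin_r.
  - destruct q as [[tq xq] yq]; unfold open_box in hqbox.
    unfold space_time, segment; lra.
Qed.

(** * Backward characteristics of the Broadwell system *)

Definition vel_x (c : R) (i : vel) : R :=
  match i with V1 => c | V4 => - c | _ => 0 end.
Definition vel_y (c : R) (i : vel) : R :=
  match i with V2 => c | V3 => - c | _ => 0 end.

Definition characteristic (c : R) (i : vel) : R -> R -> R -> R * R * R :=
  line (vel_x c i) (vel_y c i).

(** The four equations in one form: the directional derivative along the i-th
    characteristic is the i-th source term. *)
Lemma is_derive_along_characteristic (c S : R) (N : vel -> R * R * R -> R)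
    (U : R * R * R -> Prop) (i : vel) (x0 y0 s : R) :
  C1_on U (N i) -> (forall p, U p -> broadwell_at c S N p) ->
  locally (characteristic c i x0 y0 s) U ->
  is_derive (fun r => N i (characteristic c i x0 y0 r)) s
    (match i with V1 | V4 => 1 | V2 | V3 => -1 end
       * Q c S N (characteristic c i x0 y0 s)).
Proof.
  intros hC1 hsys hU.
  destruct (hsys _ (locally_singleton _ _ hU)) as [e1 [e2 [e3 e4]]].
  unfold characteristic in *.
  match goal with |- is_derive _ _ ?d => replace d with
    (d_t (N i) (line (vel_x c i) (vel_y c i) x0 y0 s)
     + vel_x c i * d_x (N i) (line (vel_x c i) (vel_y c i) x0 y0 s)
     + vel_y c i * d_y (N i) (line (vel_x c i) (vel_y c i) x0 y0 s)) end.
  - now apply is_derive_along_line with U.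
  - destruct i; simpl vel_x in *; simpl vel_y in *; lra.
Qed.

(** Going back in time along a line of positive velocity, the position decreases,
    so the first obstacle is the time [t0] or the lower end [a]. *)
Lemma entry_time (u t0 t x0 a b : R) :
  0 < u -> t0 < t -> a < x0 + u * t < b ->
  exists s0, t0 <= s0 < t /\ (s0 = t0 \/ x0 + u * s0 = a) /\
    a <= x0 + u * s0 <= b /\ forall s, s0 < s <= t -> a < x0 + u * s < b.
Proof.
  intros hu ht hx.
  assert (hinc : forall r s, r < s -> u * r < u * s)
    by (intros; now apply Rmult_lt_compat_l).
  assert (hr : u * ((a - x0) / u) = a - x0) by (field; lra).
  assert (hrt : (a - x0) / u < t).
  { apply Rmult_lt_reg_l with u; lra. }
  assert (hmain : exists s0, t0 <= s0 < t /\ (s0 = t0 \/ x0 + u * s0 = a) /\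
            a <= x0 + u * s0).
  { destruct (Rle_lt_dec t0 ((a - x0) / u)) as [h|h].
    - exists ((a - x0) / u); lra.
    - exists t0; apply hinc in h; lra. }
  destruct hmain as [s0 [h1 [h2 h3]]]; exists s0.
  pose proof (hinc s0 t (proj2 h1)).
  split; [exact h1|split; [exact h2|split; [lra|]]].
  intros s [hs1 [hs2|<-]]; [|lra].
  apply hinc in hs1; apply hinc in hs2; lra.
Qed.

(** Each component moves away from the face where it is prescribed, so a backward
    characteristic leaves the open box through that face or the initial slice.
    Negative velocities reduce to positive ones by reflecting the coordinate. *)
Lemma characteristic_entry (c a1 b1 a2 b2 t0 t1 : R)
    (N0 Nb : vel -> R * R -> R) (N M : vel -> R * R * R -> R)
    (i : vel) (x0 y0 t : R) :
  0 < c ->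
  initial_conditions a1 b1 a2 b2 t0 N0 N ->
  initial_conditions a1 b1 a2 b2 t0 N0 M ->
  boundary_conditions a1 b1 a2 b2 (segment t0 t1) Nb N ->
  boundary_conditions a1 b1 a2 b2 (segment t0 t1) Nb M ->
  open_box t0 t1 a1 b1 a2 b2 (characteristic c i x0 y0 t) ->
  exists s0, s0 <= t /\
    N i (characteristic c i x0 y0 s0) = M i (characteristic c i x0 y0 s0) /\
    space_time (segment t0 t1) a1 b1 a2 b2 (characteristic c i x0 y0 s0) /\
    forall s, s0 < s <= t -> open_box t0 t1 a1 b1 a2 b2 (characteristic c i x0 y0 s).
Proof.
  intros hc iN iM bN bM [ht [hx hy]].
  assert (H : exists s0, t0 <= s0 < t /\
            (s0 = t0 \/
             match i with
             | V1 => x0 + vel_x c i * s0 = a1 | V2 => y0 + vel_y c i * s0 = a2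
             | V3 => y0 + vel_y c i * s0 = b2 | V4 => x0 + vel_x c i * s0 = b1
             end) /\
            a1 <= x0 + vel_x c i * s0 <= b1 /\ a2 <= y0 + vel_y c i * s0 <= b2 /\
            forall s, s0 < s <= t -> a1 < x0 + vel_x c i * s < b1 /\
                                     a2 < y0 + vel_y c i * s < b2).
  { destruct i; simpl in hx, hy |- *;
      [ destruct (entry_time c t0 t x0 a1 b1) as [s0 [h1 [h2 [h3 h4]]]]
      | destruct (entry_time c t0 t y0 a2 b2) as [s0 [h1 [h2 [h3 h4]]]]
      | destruct (entry_time c t0 t (- y0) (- b2) (- a2)) as [s0 [h1 [h2 [h3 h4]]]]
      | destruct (entry_time c t0 t (- x0) (- b1) (- a1)) as [s0 [h1 [h2 [h3 h4]]]] ];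
      try lra; exists s0;
      (split; [lra|split; [lra|split; [lra|split; [lra|]]]]);
      intros s hs; specialize (h4 s hs); lra. }
  destruct H as [s0 [h1 [h2 [h3 [h4 h5]]]]]; exists s0.
  split; [lra|split; [|split]].
  - unfold characteristic, line; destruct h2 as [->|h2].
    + now rewrite iN, iM.
    + assert (hs0 : segment t0 t1 s0) by (unfold segment; lra).
      destruct (bN _ _ _ hs0 h3 h4) as [n1 [n2 [n3 n4]]].
      destruct (bM _ _ _ hs0 h3 h4) as [m1 [m2 [m3 m4]]].
      destruct i; rewrite h2; congruence.
  - unfold characteristic, line, space_time, segment; lra.
  - intros s hs; specialize (h5 s hs); unfold characteristic, line, open_box; lra.
Qed.

(** * The contraction estimate *)

(** Each product in [Q] is differenced one factor at a time, which gives four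
    terms of size at most m * A, times 2cS. *)
Lemma Q_lipschitz (c S A m : R) (N M : vel -> R * R * R -> R) (p : R * R * R) :
  0 < c -> 0 < S ->
  (forall i, Rabs (N i p) <= A) -> (forall i, Rabs (M i p) <= A) ->
  (forall i, Rabs (N i p - M i p) <= m) ->
  Rabs (Q c S N p - Q c S M p) <= 8 * c * S * A * m.
Proof.
  intros hc hS hN hM hD; unfold Q.
  assert (hmul : forall a b, Rabs a <= m -> Rabs b <= A -> - (m * A) <= a * b <= m * A).
  { intros a b ha hb; apply Rabs_le_between; rewrite Rabs_mult.
    apply Rmult_le_compat; auto using Rabs_pos. }
  pose proof (hmul _ _ (hD V2) (hN V3)); pose proof (hmul _ _ (hD V3) (hM V2)).
  pose proof (hmul _ _ (hD V1) (hN V4)); pose proof (hmul _ _ (hD V4) (hM V1)).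
  rewrite <- Rmult_minus_distr_l, Rabs_mult, (Rabs_pos_eq (2 * c * S))
    by (repeat apply Rmult_le_pos; lra).
  replace (8 * c * S * A * m) with (2 * c * S * (4 * (m * A))) by ring.
  apply Rmult_le_compat_l; [repeat apply Rmult_le_pos; lra|].
  apply Rabs_le_between; lra.
Qed.

Lemma characteristic_continuous (c : R) (i : vel) (x0 y0 s : R) :
  continuous (characteristic c i x0 y0) s.
Proof.
  assert (h : forall z0 w, continuous (fun r => z0 + w * r) s).
  { intros z0 w; apply (ex_derive_continuous (fun r => z0 + w * r)).
    auto_derive; exact I. }
  unfold characteristic, line.
  apply continuous_pair; [apply continuous_pair|]; auto; apply continuous_id.
Qed.

(** The contraction step.  By [Q_lipschitz] the difference changes along a
    characteristic at a rate of at most half the derivative of the weight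
    B exp(lam t), and it vanishes at the entry point. *)
Lemma difference_halves (c S a1 b1 a2 b2 t0 t1 A B lam : R)
    (N0 Nb : vel -> R * R -> R) (N M : vel -> R * R * R -> R) :
  0 < c -> 0 < S -> a1 < b1 -> a2 < b2 -> t0 < t1 -> 16 * c * S * A <= lam ->
  Sigma_fin_solution c S a1 b1 a2 b2 t0 t1 N0 Nb N ->
  Sigma_fin_solution c S a1 b1 a2 b2 t0 t1 N0 Nb M ->
  let D := space_time (segment t0 t1) a1 b1 a2 b2 in
  (forall i p, D p -> Rabs (N i p) <= A) ->
  (forall i p, D p -> Rabs (M i p) <= A) ->
  (forall i p, D p -> Rabs (N i p - M i p) <= B * exp (lam * fst (fst p))) ->
  forall i p, D p -> Rabs (N i p - M i p) <= B / 2 * exp (lam * fst (fst p)).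
Proof.
  intros hc hS h1 h2 ht hlam [cN [[Ps [C1N sysN]] [iN bN]]]
    [cM [[Ps' [C1M sysM]] [iM bM]]] D hN hM hB i.
  apply (le_by_density t0 t1 a1 b1 a2 b2 (Ps ++ Ps')
    (fun p => Rabs (N i p - M i p)) (fun p => B / 2 * exp (lam * fst (fst p))));
    auto.
  - apply continuous_on_comp with (E := fun _ : R => True) (f := Rabs); auto.
    + now apply continuous_on_minus.
    + apply continuous_on_forall; intros z _.
      exact (continuous_abs (K := R_AbsRing) z).
  - apply continuous_on_comp with (E := fun _ : R => True)
      (g := fun p : R * R * R => fst (fst p)) (f := fun t => B / 2 * exp (lam * t)); auto.
    + apply continuous_on_forall; intros p _.
      apply (continuous_comp fst fst); apply continuous_fst.
    + apply continuous_on_forall; intros t _.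
      apply (ex_derive_continuous (fun t => B / 2 * exp (lam * t))).
      auto_derive; exact I.
  - intros [[t x] y] hbox hoff.
    set (x0 := x - vel_x c i * t); set (y0 := y - vel_y c i * t).
    assert (hp : (t, x, y) = characteristic c i x0 y0 t).
    { unfold characteristic, line, x0, y0; f_equal; [f_equal|]; ring. }
    simpl fst; rewrite hp in *.
    destruct (characteristic_entry c a1 b1 a2 b2 t0 t1 N0 Nb N M i x0 y0 t)
      as [s0 [hs0 [heq [hin hopen]]]]; auto.
    destruct (line_off_planes _ _ _ _ _ _ hoff) as [l hl].
    assert (hclosed : forall s, s0 <= s <= t -> D (characteristic c i x0 y0 s)).
    { intros s [[hs|<-] hst]; [|exact hin].
      specialize (hopen s (conj hs hst)).
      exact (locally_singleton _ _ (open_box_interior _ _ _ _ _ _ _ hopen)). }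
    (* The hypothesis at any point, here the entry point, forces B >= 0. *)
    assert (hB0 : 0 <= B).
    { apply Rmult_le_reg_r with (exp (lam * s0)); [apply exp_pos|].
      rewrite Rmult_0_l; apply Rle_trans with (2 := hB i _ hin), Rabs_pos. }
    assert (hcont : forall f, continuous_on D f ->
              continuous_on (segment s0 t) (fun s => f (characteristic c i x0 y0 s) : R)).
    { intros f hf; apply continuous_on_comp with (E := D); auto.
      apply continuous_on_forall; intros; apply characteristic_continuous. }
    pose proof (mean_value_off_finite l
      (fun s => N i (characteristic c i x0 y0 s) - M i (characteristic c i x0 y0 s))
      (fun s => B / 2 * exp (lam * s)) (fun s => lam * B / 2 * exp (lam * s)) s0 t)
      as hmv; cbv beta in hmv.
    rewrite heq, (Rminus_eq_0 (M i _)), Rminus_0_r in hmv.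
    eapply Rle_trans; [apply hmv|].
    + exact hs0.
    + apply continuous_on_minus; apply hcont; auto.
    + intros s; auto_derive; [exact I|field].
    + intros s hs hsl; set (q := characteristic c i x0 y0 s).
      destruct (off_planes_app _ _ _ (hl s hsl)) as [o1 o2].
      assert (hq : open_box t0 t1 a1 b1 a2 b2 q) by (apply hopen; lra).
      assert (hqD : D q) by (apply hclosed; lra).
      assert (hint : locally q (Defs.interior (space_time (segment t0 t1) a1 b1 a2 b2))).
      { generalize (open_box_open _ _ _ _ _ _ _ hq).
        apply filter_imp; apply open_box_interior. }
      set (sgn := match i with V1 | V4 => 1 | V2 | V3 => -1 end).
      exists (sgn * Q c S N q - sgn * Q c S M q); split.
      * apply (is_derive_minus (fun s => N i (characteristic c i x0 y0 s))
                 (fun s => M i (characteristic c i x0 y0 s)));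
          eapply is_derive_along_characteristic; eauto;
          apply filter_and; auto; now apply off_planes_open.
      * rewrite <- Rmult_minus_distr_l, Rabs_mult.
        replace (Rabs sgn) with 1.
        2: { unfold sgn; destruct i; rewrite ?Rabs_m1, ?Rabs_R1; reflexivity. }
        rewrite Rmult_1_l.
        eapply Rle_trans.
        { apply Q_lipschitz with (A := A) (m := B * exp (lam * s)); auto. }
        replace (lam * B / 2 * exp (lam * s)) with
          (lam / 2 * (B * exp (lam * s))) by field.
        apply Rmult_le_compat_r; [|lra].
        apply Rmult_le_pos; [exact hB0|left; apply exp_pos].
    + assert (0 <= B / 2 * exp (lam * s0)).
      { apply Rmult_le_pos; [lra|left; apply exp_pos]. }
      simpl fst; lra.
Qed.

(** * Uniqueness *)

Lemma zero_of_halving_bounds (d K : R) :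
  (forall n, Rabs d <= K * (1 / 2) ^ n) -> d = 0.
Proof.
  intros H; apply NNPP; intros hd; apply Rabs_pos_lt in hd.
  assert (hK : 0 < K) by (specialize (H O); simpl in H; lra).
  destruct (pow_lt_1_zero (1 / 2)) with (y := Rabs d / K) as [n hn].
  - rewrite Rabs_pos_eq; lra.
  - now apply Rdiv_lt_0_compat.
  - specialize (hn n (le_n n)); specialize (H n).
    rewrite Rabs_pos_eq in hn by (apply pow_le; lra).
    apply Rmult_lt_compat_l with (r := K) in hn; auto.
    replace (K * (Rabs d / K)) with (Rabs d) in hn by (field; lra); lra.
Qed.

Lemma uniqueness_finite (c S a1 b1 a2 b2 t0 t1 : R)
    (N0 Nb : vel -> R * R -> R) (N M : vel -> R * R * R -> R) :
  0 < c -> 0 < S -> a1 < b1 -> a2 < b2 -> 0 <= t0 -> t0 < t1 ->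
  Sigma_fin_solution c S a1 b1 a2 b2 t0 t1 N0 Nb N ->
  Sigma_fin_solution c S a1 b1 a2 b2 t0 t1 N0 Nb M ->
  forall i p, space_time (segment t0 t1) a1 b1 a2 b2 p -> N i p = M i p.
Proof.
  intros hc hS h1 h2 ht0 ht hN hM.
  set (D := space_time (segment t0 t1) a1 b1 a2 b2).
  assert (hbound : forall N', Sigma_fin_solution c S a1 b1 a2 b2 t0 t1 N0 Nb N' ->
            exists A, 0 <= A /\ forall i p, D p -> Rabs (N' i p) <= A).
  { intros N' [hcont _].
    destruct (bounded_on_box _ _ _ _ _ _ _ (hcont V1)) as [A1 H1].
    destruct (bounded_on_box _ _ _ _ _ _ _ (hcont V2)) as [A2 H2].
    destruct (bounded_on_box _ _ _ _ _ _ _ (hcont V3)) as [A3 H3].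
    destruct (bounded_on_box _ _ _ _ _ _ _ (hcont V4)) as [A4 H4].
    exists (Rabs A1 + Rabs A2 + Rabs A3 + Rabs A4).
    pose proof (Rabs_pos A1); pose proof (Rabs_pos A2);
      pose proof (Rabs_pos A3); pose proof (Rabs_pos A4).
    pose proof (Rle_abs A1); pose proof (Rle_abs A2);
      pose proof (Rle_abs A3); pose proof (Rle_abs A4).
    split; [lra|]; intros i p hp.
    specialize (H1 p hp); specialize (H2 p hp); specialize (H3 p hp);
      specialize (H4 p hp).
    destruct i; lra. }
  destruct (hbound N hN) as [A1 [hA1 HN]], (hbound M hM) as [A2 [hA2 HM]].
  set (A := A1 + A2); set (lam := 16 * c * S * A).
  assert (hlam : 0 <= lam) by (unfold lam, A; repeat apply Rmult_le_pos; lra).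
  assert (HN' : forall i p, D p -> Rabs (N i p) <= A).
  { intros i p hp; specialize (HN i p hp); unfold A; lra. }
  assert (HM' : forall i p, D p -> Rabs (M i p) <= A).
  { intros i p hp; specialize (HM i p hp); unfold A; lra. }
  assert (Hn : forall n i p, D p ->
            Rabs (N i p - M i p) <= 2 * A * (1 / 2) ^ n * exp (lam * fst (fst p))).
  { induction n as [|n IH]; intros i p hp.
    - destruct p as [[t x] y]; simpl fst.
      assert (hexp : 1 <= exp (lam * t)).
      { assert (0 <= lam * t).
        { apply Rmult_le_pos; auto; destruct hp as [[hp _] _]; lra. }
        pose proof (exp_ineq1_le (lam * t)); lra. }
      apply Rle_trans with (2 * A * 1 * 1).
      + specialize (HN' i _ hp); specialize (HM' i _ hp).
        apply Rabs_le_between in HN'; apply Rabs_le_between in HM'.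
        apply Rabs_le_between; lra.
      + apply Rmult_le_compat_l; auto; unfold A; lra.
    - replace (2 * A * (1 / 2) ^ Datatypes.S n) with (2 * A * (1 / 2) ^ n / 2)
        by (simpl; field).
      exact (difference_halves c S a1 b1 a2 b2 t0 t1 A _ lam N0 Nb N M hc hS h1 h2 ht
        (Rle_refl _) hN hM HN' HM' IH i p hp). }
  intros i p hp; apply Rminus_diag_uniq.
  apply zero_of_halving_bounds with (2 * A * exp (lam * fst (fst p))).
  intros n; specialize (Hn n i p hp); lra.
Qed.

(** Reduces the problem on the half line to bounded time intervals. *)
Lemma solution_restrict (c S a1 b1 a2 b2 tau : R) (T T' : R -> Prop)
    (N0 Nb : vel -> R * R -> R) (N : vel -> R * R * R -> R) :
  (forall t, T' t -> T t) ->
  is_solution c S a1 b1 a2 b2 T tau N0 Nb N ->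
  is_solution c S a1 b1 a2 b2 T' tau N0 Nb N.
Proof.
  intros hT [cN [[Ps [C1N sysN]] [iN bN]]].
  assert (hsub : forall p, space_time T' a1 b1 a2 b2 p -> space_time T a1 b1 a2 b2 p).
  { intros [[t x] y] [h1 h2]; split; auto. }
  assert (hint : forall p,
            Defs.interior (space_time T' a1 b1 a2 b2) p /\ off_planes Ps p ->
            Defs.interior (space_time T a1 b1 a2 b2) p /\ off_planes Ps p).
  { intros p [h1 h2]; split; auto.
    unfold Defs.interior in *; revert h1; apply filter_imp; auto. }
  split; [|split; [|split]].
  - intros i; apply continuous_on_subset with (2 := cN i); exact hsub.
  - exists Ps; split.
    + intros i; destruct (C1N i) as [h1 [h2 [h3 h4]]].
      split; [|split; [|split]].
      * intros t x y h; apply h1, hint, h.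
      * apply continuous_on_subset with (2 := h2); exact hint.
      * apply continuous_on_subset with (2 := h3); exact hint.
      * apply continuous_on_subset with (2 := h4); exact hint.
    + intros p h; apply sysN, hint, h.
  - exact iN.
  - intros t x y ht; apply bN, hT, ht.
Qed.

Theorem theorem2p1 (c S a1 b1 a2 b2 : R)
    (hc : 0 < c) (hS : 0 < S) (h1 : a1 < b1) (h2 : a2 < b2) :
  (forall (tau tau' : R) (N0 Nb : vel -> R * R -> R),
     0 <= tau -> tau < tau' ->
     Sigma_fin_data a1 b1 a2 b2 tau tau' N0 Nb ->
     forall N M : vel -> R * R * R -> R,
       Sigma_fin_solution c S a1 b1 a2 b2 tau tau' N0 Nb N ->
       Sigma_fin_solution c S a1 b1 a2 b2 tau tau' N0 Nb M ->
       forall i p, space_time (segment tau tau') a1 b1 a2 b2 p -> N i p = M i p) /\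
  (forall N0 Nb : vel -> R * R -> R,
     Sigma_data a1 b1 a2 b2 N0 Nb ->
     forall N M : vel -> R * R * R -> R,
       Sigma_solution c S a1 b1 a2 b2 N0 Nb N ->
       Sigma_solution c S a1 b1 a2 b2 N0 Nb M ->
       forall i p, space_time (half_line 0) a1 b1 a2 b2 p -> N i p = M i p).
Proof.
  split.
  - intros tau tau' N0 Nb h0 ht _ N M hN hM.
    now apply (uniqueness_finite c S a1 b1 a2 b2 tau tau' N0 Nb).
  - intros N0 Nb _ N M hN hM i [[t x] y] [ht hxy]; unfold half_line in ht.
    apply (uniqueness_finite c S a1 b1 a2 b2 0 (t + 1) N0 Nb); auto; try lra.
    + apply solution_restrict with (2 := hN); intros s hs; apply hs.
    + apply solution_restrict with (2 := hM); intros s hs; apply hs.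
    + split; [unfold segment; lra | exact hxy].
Qed.
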